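(* Let $r\in\mathbb{N}$, $\alpha>1$, $a>0$ and $c\in\mathbb{R}$ with $a+c>0$. Let $$A^r_{c,a}=\Big\{\xi\in\mathbb{D}:\sup_{t\in[0,1]}\{\xi(t)-ct-\mathfrak{J}^r_\xi(t)\}\ge a\Big\},$$ $$\mathcal{A}^r_{c,a}=\Big\{\xi\in\mathbb{D}:\sup_{t\in[0,1]}\{\xi(t)-ct-(r+1)\mathfrak{J}^r_\xi(t)+r\,\mathfrak{J}^{r+1}_\xi(t)\}\ge a\Big\}.$$ Then both sets are $C_{r+1}$-continuous, i.e. $C_{r+1}(\partial A^r_{c,a})=C_{r+1}(\partial\mathcal{A}^r_{c,a})=0$, where $\partial A=\bar A\setminus A^\circ$ is the boundary of $A$ (closure minus interior) in the Skorokhod $J_1$ topology on $\mathbb{D}$.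
   Context: $\mathbb{D}$ is the space of real-valued càdlàg functions on $[0,1]$ with the $J_1$-metric $d(\xi,\zeta)=\inf_{h\in\Lambda}\{\|h-id\|\vee\|\xi-\zeta\circ h\|\}$, where $\Lambda$ is the set of all strictly increasing continuous bijections of $[0,1]$ to itself, $id$ is the identity and $\|\cdot\|$ the sup norm. For $\xi\in\mathbb{D}$ and $m\in\mathbb{N}=\{1,2,\dots\}$, $$\mathfrak{J}^m_\xi(t)=\sup\Big\{\sum_{i=1}^m\big(\xi(s_i)-\xi(s_i^-)\big):\ (s_1,\dots,s_m)\in[0,t]^m,\ s_i\ne s_j\ \text{for } i\neq j\Big\},\quad t\in(0,1],$$ and $\mathfrak{J}^m_\xi(0)=0$, with $\xi(s^-)$ the left limit of $\xi$ at $s$ and the convention $\xi(0^-)=\xi(0)$. Let $\nu_\alpha$ be the measure on $(0,\infty)$ with $\nu_\alpha(x,\infty)=x^{-\alpha}$ for $x>0$, and let $\nu_\alpha^j$ be the restriction to $\{x\in\mathbb{R}_+^j: x_1\ge x_2\ge\dots\ge x_j>0\}$ of the $j$-fold product measure of $\nu_\alpha$. For $j\ge1$ the measure $C_j$ on $\mathbb{D}$ is $$C_j(\bullet)=\mathbb{E}\Big[\nu_\alpha^j\Big\{y\in\mathbb{R}_+^j:\sum_{i=1}^j y_i\,\mathbf{1}_{[U_i,1]}\in\bullet\Big\}\Big],$$ where $U_1,\dots,U_j$ are i.i.d. uniform on $[0,1]$ and $\mathbf{1}_B$ denotes the indicator function of $B$. *)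

(* Defs.v *)
From HB Require Import structures.
From mathcomp Require Import all_boot all_order all_algebra.
From mathcomp Require Import all_classical all_reals all_analysis.
From mathcomp Require Import lra.

Set Implicit Arguments.
Unset Strict Implicit.
Unset Printing Implicit Defensive.

Import Order.TTheory GRing.Theory Num.Theory numFieldNormedType.Exports.
Local Open Scope classical_set_scope.
Local Open Scope ring_scope.

Section skorokhod_space.
Variable R : realType.
Implicit Types (xi zeta : R -> R).

(* At 0 the left limit, and at 1 the right limit, are not constrained. *)
Definition cadlag xi : Prop :=
  (forall t : R, 0 <= t < 1 -> xi x @[x --> t^'+] --> xi t) /\
  (forall t : R, 0 < t <= 1 -> cvg (xi x @[x --> t^'-])).

(* A function on [0, 1] is encoded by its extension by 0 to the whole line, so
   that Leibniz equality is equality on [0, 1] (skorokhod_eq). *)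
Record skorokhod := Skorokhod {
  skfun :> R -> R ;
  skfun_cadlag : cadlag skfun ;
  skfun_out : forall t : R, ~~ (0 <= t <= 1) -> skfun t = 0 }.

HB.instance Definition _ := gen_eqMixin skorokhod.
HB.instance Definition _ := gen_choiceMixin skorokhod.

Lemma skorokhod_eq (x y : skorokhod) :
  (forall t : R, 0 <= t <= 1 -> x t = y t) -> x = y.
Proof.
case: x y => [x xc xo] [y yc yo] /= xy.
have exy : x = y.
  apply/funext => t; case: (boolP (0 <= t <= 1)) => [/xy//|tn].
  by rewrite xo ?yo.
by subst y; f_equal; exact: Prop_irrelevance.
Qed.

Lemma cadlag_bounded xi : cadlag xi ->
  exists M, forall t : R, 0 <= t <= 1 -> `|xi t| <= M.
Proof.
move=> [xr xl].
pose P (M : R) (t : R) := 0 <= t <= 1 -> `|xi t| <= M.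
have near_bnd (F : set_system R) (l : R) : Filter F -> xi @ F --> l ->
    \forall t \near F, `|xi t| <= `|l| + 1.
  move=> FF /cvgrPdist_le /(_ 1 ltr01); apply: filterS => t lt.
  by rewrite (le_trans _ (lerD (lexx _) lt))// -lerBlDl distrC lerB_dist.
have loc : forall t : R, `[0, 1]%classic t -> \forall t' \near t & M \near +oo, P M t'.
  move=> t /=; rewrite in_itv/= => /andP[t0 t1].
  have [Mr Hr] : exists M, \forall x \near t^'+, 0 <= x <= 1 -> `|xi x| <= M.
    move: t1; rewrite le_eqVlt => /orP[/eqP ->|t1].
      exists 0; near=> x => /andP[_]; rewrite leNgt => /negP[].
      by near: x; exact: nbhs_right_gt.
    exists (`|xi t| + 1); have tt : 0 <= t < 1 by rewrite t0.
    by apply: filterS (near_bnd _ _ _ (xr t tt)).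
  have [Ml Hl] : exists M, \forall x \near t^'-, 0 <= x <= 1 -> `|xi x| <= M.
    move: t0; rewrite le_eqVlt => /orP[/eqP <-|t0].
      exists 0; near=> x => /andP[+ _]; rewrite leNgt => /negP[].
      by near: x; exact: nbhs_left_lt.
    have tt : 0 < t <= 1 by rewrite t0.
    exists (`|lim (xi x @[x --> t^'-])| + 1).
    by apply: filterS (near_bnd _ _ _ (xl t tt)).
  pose M0 := Num.max `|xi t| (Num.max Mr Ml).
  have HM : \forall x \near t, 0 <= x <= 1 -> `|xi x| <= M0.
    have Hr' : \forall x \near t, t < x -> 0 <= x <= 1 -> `|xi x| <= Mr := Hr.
    have Hl' : \forall x \near t, x < t -> 0 <= x <= 1 -> `|xi x| <= Ml := Hl.
    apply: filterS2 Hl' Hr' => x HL HR x01; rewrite /M0 !le_max.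
    by case: (ltgtP x t) => [/HL/(_ x01) ->|/HR/(_ x01) ->|->];
      rewrite ?lexx ?orbT.
  exists ([set x | 0 <= x <= 1 -> `|xi x| <= M0], [set M | M0 < M]) => /=.
    by split => //; apply: nbhs_pinfty_gt; exact: num_real.
  by move=> [x M] /= [Hx HM'] /Hx /le_trans; apply; exact: ltW.
have := @segment_compact R 0 1; move/compact_near_coveringP.
move=> /(_ _ _ P _ loc) [M [_ HM]].
exists (M + 1) => t t01; apply: (HM (M + 1)) => //=.
  by rewrite ltrDl.
Unshelve. all: by end_near. Qed.

Definition time_change : set (R -> R) := [set h : R -> R |
  [/\ set_bij `[0, 1] `[0, 1] h,
      {in `[0, 1] &, {homo h : x y / x < y}} &
      {within `[0, 1], continuous h}]].

(* Only applied to functions bounded on [0, 1] (cadlag_bounded). *)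
Definition supnorm (f : R -> R) : R := sup [set `|f t| | t in `[0, 1]].

Definition J1_dist xi zeta : R :=
  inf [set Num.max (supnorm (fun t => h t - t))
                   (supnorm (fun t => xi t - zeta (h t))) | h in time_change].

Lemma supnorm_le f e :
  (forall t : R, 0 <= t <= 1 -> `|f t| <= e) -> supnorm f <= e.
Proof.
move=> fe; apply: ge_sup; first by exists `|f 0|; exists 0; rewrite //= in_itv/= lexx ler01.
by move=> _ [t +] <-; rewrite /= in_itv/=; exact: fe.
Qed.

Lemma le_supnorm f M t : (forall s : R, 0 <= s <= 1 -> `|f s| <= M) ->
  0 <= t <= 1 -> `|f t| <= supnorm f.
Proof.
move=> fM t01; apply: ub_le_sup; last by exists t.
by exists M => _ [s +] <-; rewrite /= in_itv/=; exact: fM.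
Qed.

Lemma supnorm_ge0 f : 0 <= supnorm f.
Proof.
have [b|/sup_out] := pselect (has_sup [set `|f t| | t in `[0, 1]]); last by rewrite /supnorm => ->.
apply: (@le_trans _ _ `|f 0|) => //; apply: ub_le_sup; first by case: b.
by exists 0; rewrite //= in_itv/= lexx ler01.
Qed.

Lemma time_change01 h t : time_change h -> 0 <= t <= 1 -> 0 <= h t <= 1.
Proof.
case=> bh _ _; have := set_bij_homo bh; move=> /(_ t) /=.
by rewrite !in_itv/=.
Qed.

Lemma time_change_id : time_change id.
Proof.
split => //; last by apply: continuous_subspaceT => x; exact: cvg_id.
split => //.
by move=> x /= x01; exists x.
Qed.

Lemma J1_dist_ge0 xi zeta : 0 <= J1_dist xi zeta.
Proof.
apply: lb_le_inf; first by eexists; exists id => //; exact: time_change_id.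
by move=> _ [h _ <-]; rewrite le_max supnorm_ge0.
Qed.

Lemma J1_dist_le xi zeta h e : time_change h ->
  (forall t : R, 0 <= t <= 1 -> `|h t - t| <= e /\ `|xi t - zeta (h t)| <= e) ->
  J1_dist xi zeta <= e.
Proof.
move=> hh He.
apply: (@le_trans _ _ (Num.max (supnorm (fun t => h t - t))
                   (supnorm (fun t => xi t - zeta (h t))))).
  apply: ge_inf; last by exists h.
  by exists 0 => _ [g _ <-]; rewrite le_max supnorm_ge0.
by rewrite ge_max; apply/andP; split; apply: supnorm_le => t /He[].
Qed.

Lemma J1_dist_lt (x y : skorokhod) e : J1_dist x y < e ->
  exists2 h, time_change h &
    forall t : R, 0 <= t <= 1 -> `|h t - t| < e /\ `|x t - y (h t)| < e.
Proof.
move=> /inf_lt[].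
  by eexists; exists id => //; exact: time_change_id.
move=> _ [h hh <-]; rewrite gt_max => /andP[h1 h2].
exists h => // t t01; split.
  apply: le_lt_trans h1; apply: (@le_supnorm (fun t => h t - t) 1) => // s s01.
  by have := time_change01 hh s01; rewrite ler_norml; lra.
apply: le_lt_trans h2.
have [Mx Hx] := cadlag_bounded (skfun_cadlag x).
have [My Hy] := cadlag_bounded (skfun_cadlag y).
apply: (@le_supnorm (fun t => x t - y (h t)) (Mx + My)) => // s s01.
rewrite (le_trans (ler_normB _ _))// lerD//; first exact: Hx.
by apply: Hy; exact: time_change01.
Qed.

Lemma time_changeP h : set_bij `[0, 1] `[0, 1] h ->
  {in `[0, 1] &, {homo h : x y / x < y}} -> time_change h.
Proof.
move=> hb hi; split => //.
have h01 x : 0 <= x <= 1 -> 0 <= h x <= 1.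
  by have /(_ x) /= := set_bij_homo hb; rewrite !in_itv/=.
have hm : {in `[0, 1] &, {mono h : x y / x <= y}} by exact: le_mono_in.
have in0 : (0 : R) \in `[0, 1] by rewrite in_itv/= lexx ler01.
have in1 : (1 : R) \in `[0, 1] by rewrite in_itv/= lexx ler01.
have sj := set_bij_surj hb.
have h0 : h 0 = 0.
  have [x /= x01 hx] := sj 0 in0.
  apply/eqP; rewrite eq_le; have /andP[-> _] := h01 0 in0.
  by rewrite andbT -{2}hx hm//; move: x01; rewrite in_itv/= => /andP[].
have h1 : h 1 = 1.
  have [x /= x01 hx] := sj 1 in1.
  apply/eqP; rewrite eq_le; have /andP[_ ->] := h01 1 in1.
  by rewrite /= -{1}hx hm//; move: x01; rewrite in_itv/= => /andP[].
by apply: segment_inc_surj_continuous => //; rewrite h0 h1.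
Qed.

Lemma time_change_comp g h :
  time_change g -> time_change h -> time_change (g \o h).
Proof.
move=> [gb gi _] [hb hi _]; apply: time_changeP.
  exact: set_bij_comp hb gb.
move=> s t s01 t01 st; rewrite /=.
by apply: gi; [exact: (set_bij_homo hb)|exact: (set_bij_homo hb)|exact: hi].
Qed.

Lemma time_change_inv h : time_change h -> exists2 g, time_change g &
  forall t : R, 0 <= t <= 1 -> 0 <= g t <= 1 /\ h (g t) = t.
Proof.
move=> [hb hi _].
have sj := set_bij_surj hb.
have /choice[g Hg] : forall t, exists s, 0 <= t <= 1 -> 0 <= s <= 1 /\ h s = t.
  move=> t; case: (boolP (0 <= t <= 1)) => t01; last by exists 0.
  have [|s s01 hs] := sj t; first by rewrite /= in_itv.
  by exists s => _; move: s01; rewrite /= in_itv.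
exists g => //; apply: time_changeP.
  split.
  - by move=> t /=; rewrite !in_itv/= => /Hg[].
  - move=> s t; rewrite !inE/= !in_itv/= => /Hg[_ {2}<-] /Hg[_ {2}<-].
    by move=> ->.
  - move=> s /= s01; have hs01 : h s \in `[0, 1] by exact: (set_bij_homo hb).
    exists (h s) => //; move: (hs01); rewrite in_itv/= => /Hg[gs e].
    by apply: (set_bij_inj hb) => //; rewrite inE//= in_itv.
move=> s t; rewrite !in_itv/= => /Hg[gs es] /Hg[gt et] st.
rewrite ltNge; apply/negP; rewrite le_eqVlt => /orP[/eqP e|gts].
  by move: st; rewrite -es -et e ltxx.
by have := hi _ _ gt gs gts; rewrite es et => /(lt_trans st); rewrite ltxx.
Qed.

Lemma J1_distxx xi : J1_dist xi xi = 0.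
Proof.
apply/eqP; rewrite eq_le J1_dist_ge0 andbT.
by apply: (J1_dist_le time_change_id) => t _; rewrite /= !subrr normr0.
Qed.

Lemma J1_dist_sym (x y : skorokhod) : J1_dist x y = J1_dist y x.
Proof.
wlog suff : x y / J1_dist y x <= J1_dist x y.
  by move=> H; apply/eqP; rewrite eq_le !H.
apply/ler_addgt0Pr => e e0.
have [|h hh He] := @J1_dist_lt x y (J1_dist x y + e); first by rewrite ltrDl.
have [g hg Hg] := time_change_inv hh.
apply: (J1_dist_le hg) => t /Hg[gt et].
have [/ltW a /ltW b] := He _ gt.
by rewrite et in a b; rewrite distrC a distrC b.
Qed.

Lemma J1_dist_triangle (y x z : skorokhod) :
  J1_dist x z <= J1_dist x y + J1_dist y z.
Proof.
apply/ler_addgt0Pr => e e0; have e20 : 0 < e / 2 by rewrite divr_gt0.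
have [|h hh Hh] := @J1_dist_lt x y (J1_dist x y + e / 2).
  by rewrite ltrDl.
have [|g hg Hg] := @J1_dist_lt y z (J1_dist y z + e / 2).
  by rewrite ltrDl.
have -> : J1_dist x y + J1_dist y z + e =
   (J1_dist x y + e / 2) + (J1_dist y z + e / 2) by rewrite addrACA -splitr.
apply: (J1_dist_le (time_change_comp hg hh)) => t t01 /=.
have [/ltW a1 /ltW a2] := Hh _ t01.
have [/ltW b1 /ltW b2] := Hg _ (time_change01 hh t01).
split; last by rewrite (le_trans (ler_distD (y (h t)) _ _))// lerD.
by rewrite (le_trans (ler_distD (h t) _ _))// addrC lerD.
Qed.

Lemma time_change1 h : time_change h -> h 1 = 1.
Proof.
move=> hh; have [g hg /(_ 1)] := time_change_inv hh.
rewrite lexx ler01 => /(_ isT)[/andP[g0 g1] e].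
move: g1; rewrite le_eqVlt => /orP[/eqP g1|g1]; first by rewrite -[in LHS]g1 e.
have [_ hi _] := hh; have := hi (g 1) 1.
rewrite !in_itv/= g0 (ltW g1) lexx ler01 => /(_ isT isT g1); rewrite e.
have := time_change01 hh; move=> /(_ 1); rewrite ler01 lexx => /(_ isT).
by move=> /andP[_ + ?]; lra.
Qed.

Lemma J1_dist_positivity (x y : skorokhod) : J1_dist x y = 0 -> x = y.
Proof.
move=> d0.
have key e : 0 < e -> exists2 h, time_change h &
    forall t : R, 0 <= t <= 1 -> `|h t - t| < e /\ `|x t - y (h t)| < e.
  by move=> e0; apply: J1_dist_lt; rewrite d0.
apply: skorokhod_eq => t /andP[t0]; rewrite le_eqVlt => /orP[/eqP ->|t1].
  apply/eqP; rewrite -subr_eq0 -normr_le0; apply/ler_addgt0Pr => e e0; rewrite add0r.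
  have [h hh] := key _ e0; move=> /(_ 1); rewrite lexx ler01 => /(_ isT)[_].
  by rewrite (time_change1 hh) => /ltW.
apply/eqP; rewrite -subr_eq0 -normr_le0; apply/ler_addgt0Pr => e e0; rewrite add0r.
have tt : 0 <= t < 1 by rewrite t0.
have e30 : 0 < e / 3 by rewrite divr_gt0.
have /cvgrPdist_lt/(_ _ e30) := (skfun_cadlag x).1 t tt.
have /cvgrPdist_lt/(_ _ e30) := (skfun_cadlag y).1 t tt.
rewrite !near_withinE => Hy Hx.
have : \forall s \near t, (t < s -> `|x t - x s| < e / 3) /\
    (t < s -> `|y t - y s| < e / 3) by exact: filterS2 Hx Hy.
move=> /nbhs_ballP[r /= r0 Hr].
pose q := Num.min r (1 - t).
have q0 : 0 < q by rewrite lt_min r0 subr_gt0.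
have qr : q <= r by rewrite ge_min lexx.
have q1 : q <= 1 - t by rewrite ge_min lexx orbT.
pose s := t + q / 2.
have [|h hh] := key (Num.min (e / 3) (q / 2)).
  by rewrite lt_min e30 divr_gt0.
move=> /(_ s) []; first by rewrite /s; lra.
rewrite !lt_min => /andP[_ hs] /andP[xy _].
have [|+ _] := Hr s; first by rewrite /ball/= /s ltr_distl; lra.
have [|_] := Hr (h s).
  by move: hs; rewrite /ball/= /s !ltr_distl => /andP[? ?]; apply/andP; split; lra.
move: hs; rewrite ltr_distl => /andP[h1 h2] A B.
have ts : t < s by rewrite /s; lra.
have ths : t < h s by apply: le_lt_trans h1; rewrite /s; lra.
move: (B ts) (A ths) xy; rewrite !ltr_distl => /andP[? ?] /andP[? ?] /andP[? ?].
by rewrite ler_distl; apply/andP; split; lra.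
Qed.

(* The topology of skorokhod (closure, interior, etc) is the one of J1_dist. *)
HB.instance Definition _ := @isMetric.Build R skorokhod
  (fun x y => J1_dist x y) (fun x => J1_distxx x) J1_dist_positivity
  J1_dist_sym J1_dist_triangle.

Lemma mdistE (x y : skorokhod) : mdist x y = J1_dist x y.
Proof. by []. Qed.

End skorokhod_space.

Definition boundary (T : topologicalType) (A : set T) : set T :=
  closure A `\` interior A.

Section jump_functional.
Variable R : realType.
Implicit Types (xi : skorokhod R) (r m : nat) (a c t : R).

Definition left_limit xi t : R :=
  if t == 0 then xi 0 else lim (xi x @[x --> t^'-]).

Definition jump xi t : R := xi t - left_limit xi t.

(* For 0 < t <= 1 the set is nonempty and bounded above (has_sup_jump_sums). *)
Definition jump_sum_sup m xi t : R :=
  if t == 0 then 0 else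
  sup [set \sum_(i < m) jump xi (s i) |
        s in [set s : 'I_m -> R | (forall i, 0 <= s i <= t) /\ injective s]].

(* The suprema are over nonempty sets that are bounded since xi is. *)
Definition A_set r c a : set (skorokhod R) := [set xi : skorokhod R |
  a <= sup [set xi t - c * t - jump_sum_sup r xi t | t in `[0, 1]]].

Definition calA_set r c a : set (skorokhod R) := [set xi : skorokhod R |
  a <= sup [set xi t - c * t - r.+1%:R * jump_sum_sup r xi t
                + r%:R * jump_sum_sup r.+1 xi t | t in `[0, 1]]].

Lemma jump_bounded xi : exists M, forall t, 0 <= t <= 1 -> jump xi t <= M.
Proof.
have [M HM] := cadlag_bounded (skfun_cadlag xi).
exists (M + M) => t t01.
have M0 : 0 <= M by rewrite (le_trans _ (HM _ t01)).
have L : - M <= left_limit xi t.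
  rewrite /left_limit; case: ifPn => [|tn0].
    by move=> _; have := HM 0; rewrite lexx ler01 => /(_ isT); rewrite ler_norml => /andP[].
  have t0 : 0 < t <= 1.
    by case/andP: t01 => t0 ->; rewrite lt_neqAle eq_sym tn0 t0.
  apply: limr_ge; first exact: (skfun_cadlag xi).2 t t0.
  have /andP[t_gt0 t_le1] := t0.
  near=> x; have : 0 <= x <= 1.
    apply/andP; split.
      by near: x; exact: nbhs_left_ge.
    by apply: le_trans t_le1; near: x; exact: nbhs_left_le.
  by move=> /HM; rewrite ler_norml => /andP[].
rewrite /jump; have := HM _ t01; rewrite ler_norml => /andP[_ ?]; lra.
Unshelve. all: by end_near. Qed.

Lemma has_sup_jump_sums m xi t : 0 < t <= 1 ->
  has_sup [set \sum_(i < m) jump xi (s i) |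
    s in [set s : 'I_m -> R | (forall i, 0 <= s i <= t) /\ injective s]].
Proof.
move=> /andP[t0 t1]; split.
  eexists; exists (fun i : 'I_m => t / i.+1%:R) => //; split.
    move=> i; rewrite divr_ge0//= ?(ltW t0)// ler_pdivrMr// ler_peMr ?(ltW t0)//.
    by rewrite ler1n.
  move=> i j /(mulfI (lt0r_neq0 t0))/invr_inj/eqP.
  by rewrite eqr_nat eqSS => /eqP/val_inj.
have [M HM] := jump_bounded xi.
exists (\sum_(i < m) M) => _ [s [s0t _] <-]; apply: ler_sum => i _; apply: HM.
by case/andP: (s0t i) => -> /= /le_trans; apply.
Qed.

(* \sum_i y_i 1_[u_i, 1] as a function on [0, 1]; the restriction only matters
   when some u_i is negative. *)
Definition jump_fun n (u y : 'I_n -> R) : R -> R :=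
  (fun t => \sum_(i < n) y i * \1_(`[u i, 1]) t) \_ `[0, 1].

Lemma jump_fun_cadlag n (u y : 'I_n -> R) : cadlag (jump_fun u y).
Proof.
have E (t : R) : 0 <= t <= 1 ->
    jump_fun u y t = \sum_(i < n) y i * (u i <= t)%R%:R.
  move=> t01; rewrite /jump_fun patchE mem_setE in_itv/= t01.
  apply: eq_bigr => i _; rewrite indicE mem_setE in_itv/=.
  by case/andP: t01 => _ ->; rewrite andbT.
split=> t /andP[t0 t1].
  rewrite E ?t0 ?ltW//.
  apply: (@cvg_trans _ (\sum_(i < n) y i * (u i <= x)%R%:R @[x --> t^'+])).
    apply: near_eq_cvg; near=> x; rewrite E//; apply/andP; split.
      by rewrite (le_trans t0).
    by near: x; apply: nbhs_right_le.
  apply: cvg_big => [|i _]; [exact: add_continuous|apply: cvg_near_cst].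
  case: (leP (u i) t) => ut; near=> x; congr (_ * (nat_of_bool _)%:R).
    by apply: (le_trans ut).
  by apply/negbTE; rewrite -ltNge; near: x; exact: nbhs_right_lt.
apply/cvg_ex; exists (\sum_(i < n) y i * (u i < t)%R%:R).
apply: (@cvg_trans _ (\sum_(i < n) y i * (u i <= x)%R%:R @[x --> t^'-])).
  apply: near_eq_cvg; near=> x; rewrite E//; apply/andP; split.
    by near: x; exact: nbhs_left_ge.
  by rewrite (le_trans _ t1).
apply: cvg_big => [|i _]; [exact: add_continuous|apply: cvg_near_cst].
case: (ltP (u i) t) => ut; near=> x; congr (_ * (nat_of_bool _)%:R).
  by near: x; exact: nbhs_left_ge.
by apply/negbTE; rewrite -ltNge; apply: lt_le_trans ut.
Unshelve. all: by end_near. Qed.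

Lemma jump_fun_out n (u y : 'I_n -> R) t : ~~ (0 <= t <= 1) -> jump_fun u y t = 0.
Proof. by move=> t01; rewrite /jump_fun patchE mem_setE in_itv/= (negbTE t01). Qed.

Definition jump_path n (u y : 'I_n -> R) : skorokhod R :=
  Skorokhod (@jump_fun_cadlag n u y) (@jump_fun_out n u y).
End jump_functional.

Section tuple_product.
Local Open Scope ereal_scope.
Context d (T : measurableType d) (R : realType).
Variables (m1 : {sigma_finite_measure set T -> \bar R}) (n : nat).
Variable m2 : {sigma_finite_measure set (n.-tuple T) -> \bar R}.

Let consp (p : T * n.-tuple T) : n.+1.-tuple T := [tuple of p.1 :: p.2].

Definition cons_measure : set (n.+1.-tuple T) -> \bar R :=
  pushforward (m1 \x m2) consp.

Let mconsp : measurable_fun setT consp.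
Proof. exact: measurable_cons. Qed.

Let cons_measure0 : cons_measure set0 = 0.
Proof. by rewrite /cons_measure/pushforward preimage_set0 measure0. Qed.

Let cons_measure_ge0 A : 0 <= cons_measure A.
Proof. exact: measure_ge0. Qed.

Let cons_measure_sigma : semi_sigma_additive cons_measure.
Proof.
move=> F mF tF mUF; rewrite /cons_measure /pushforward preimage_bigcup.
apply: measure_semi_sigma_additive.
- by move=> k; rewrite -[X in measurable X]setTI; exact: mconsp.
- apply/trivIsetP => /= i j _ _ ij; rewrite -preimage_setI.
  by move/trivIsetP : tF => /(_ _ _ _ _ ij) ->//; rewrite preimage_set0.
- by rewrite -preimage_bigcup -[X in measurable X]setTI; exact: mconsp.
Qed.

HB.instance Definition _ := isMeasure.Build _ _ _ cons_measure
  cons_measure0 cons_measure_ge0 cons_measure_sigma.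

Let cons_measure_sigma_finite : sigma_finite setT cons_measure.
Proof.
have /sigma_finiteP[F [TF ndF Foo]] := sigma_finiteT m1.
have /sigma_finiteP[G [TG ndG Goo]] := sigma_finiteT m2.
pose g (y : n.+1.-tuple T) := (thead y, [tuple of behead y]).
have mg : measurable_fun setT g.
  apply: measurable_fun_pair; first exact: measurable_tnth.
  exact: measurable_behead.
have gK p : g (consp p) = p.
  by case: p => a b; rewrite /g /consp/=; congr pair; apply/val_inj.
exists (fun k => g @^-1` (F k `*` G k)).
  rewrite -preimage_bigcup (_ : \bigcup_k _ = setT) ?preimage_setT//.
  apply/seteqP; split => // -[x y] _.
  have [i _ Fx] : (\bigcup_i F i) x by rewrite -TF.
  have [j _ Gy] : (\bigcup_i G i) y by rewrite -TG.
  exists (maxn i j) => //; split => /=.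
    by move: x Fx; exact/subsetPset/ndF/leq_maxl.
  by move: y Gy; exact/subsetPset/ndG/leq_maxr.
move=> k; have [mF oF] := Foo k; have [mG oG] := Goo k; split.
  by rewrite -[X in measurable X]setTI; apply: mg => //; exact: measurableX.
rewrite /cons_measure /pushforward.
rewrite (_ : _ @^-1` _ = F k `*` G k); last first.
  have gpK p : (g \o consp) p = p by exact: gK.
  by rewrite -comp_preimage; apply/seteqP; split=> p; rewrite /preimage/mkset gpK.
by rewrite product_measure1E// lte_mul_pinfty// ge0_fin_numE.
Qed.

HB.instance Definition _ := Measure_isSigmaFinite.Build _ _ _ cons_measure
  cons_measure_sigma_finite.
End tuple_product.

(* n-fold product measure; power_measureE gives its values on boxes. *)
Fixpoint power_measure d (T : measurableType d) (R : realType)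
    (nu : {sigma_finite_measure set T -> \bar R}) n :
    {sigma_finite_measure set (n.-tuple T) -> \bar R} :=
  if n is n'.+1 then cons_measure nu (power_measure nu n') else \d_[tuple].

Lemma power_measureE d (T : measurableType d) (R : realType)
    (nu : {sigma_finite_measure set T -> \bar R}) n (A : 'I_n -> set T) :
  (forall i, measurable (A i)) ->
  power_measure nu n [set y | forall i, A i (tnth y i)] =
  (\prod_(i < n) nu (A i))%E.
Proof.
elim: n A => [|n IH] A mA.
  rewrite big_ord0 /= diracE mem_set//=; by case.
rewrite big_ord_recl /= /cons_measure /pushforward.
rewrite (_ : _ @^-1` _ =
    A ord0 `*` [set y | forall i, A (lift ord0 i) (tnth y i)]); last first.
  apply/seteqP; split=> [[a y] /= H|[a y] /= [H0 H] i].
    by split=> [|i]; [exact: (H ord0)|have := H (lift ord0 i); rewrite tnthS].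
  have [->//|i0] := eqVneq i ord0.
  have [j ->] : exists j, i = lift ord0 j.
    by case: (unliftP ord0 i) i0 => [j ->|->]; [exists j|rewrite eqxx].
  by rewrite tnthS; exact: H.
rewrite product_measure1E//; first by congr (_ * _)%E; apply: IH.
rewrite (_ : mkset _ = \bigcap_(i in [set: 'I_n]) ((fun y : n.-tuple T => tnth y i) @^-1` A (lift ord0 i))).
  apply: fin_bigcap_measurable => // i _.
  rewrite -[X in measurable X]setTI; exact: measurable_tnth.
by apply/seteqP; split=> y /= H i; [move=> _; exact: H|exact: H].
Qed.


Section tail.
Variable R : realType.

(* A measure on (0, +oo) is seen as a measure on R that does not charge
   ]-oo, 0]; the conditions characterize it among all Borel measures, and imply
   sigma-finiteness. *)
Definition power_tail (alpha : R) (nu : set R -> \bar R) : Prop :=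
  nu `]-oo, 0]%classic = 0%E /\
  forall x : R, 0 < x -> nu `]x, +oo[%classic = (x `^ (- alpha))%:E.

Section existence.
Variables (alpha : R) (alpha_gt0 : 0 < alpha).
Local Notation lam := (@lebesgue_measure R).
(* The image under u |-> u^(-1/alpha) of Lebesgue measure on ]0, +oo[. *)
Let f (u : R) : R := u `^ (- alpha^-1).
Definition tail_measure (A : set R) : \bar R := lam (`]0, +oo[%classic `&` f @^-1` A).

Let mf (A : set R) : measurable A -> measurable (`]0, +oo[%classic `&` f @^-1` A).
Proof.
move=> mA; apply: measurableI => //; rewrite -[X in measurable X]setTI.
have mff : measurable_fun setT f by rewrite /f.
exact: mff.
Qed.

Local Notation nu := tail_measure.

Let nu0 : nu set0 = 0%E.
Proof. by rewrite /tail_measure preimage_set0 setI0 measure0. Qed.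

Let nu_ge0 A : (0 <= nu A)%E.
Proof. exact: measure_ge0. Qed.

Let nu_sigma : semi_sigma_additive nu.
Proof.
move=> F mF tF mUF; rewrite /tail_measure preimage_bigcup setI_bigcupr.
apply: measure_semi_sigma_additive.
- by move=> k; exact: mf.
- apply/trivIsetP => /= i j _ _ ij; rewrite -subset0 => x [[_ Fi] [_ Fj]].
  move/trivIsetP : tF => /(_ _ _ I I ij); rewrite -subset0 => /(_ (f x)).
  by apply; split.
- by rewrite -setI_bigcupr -preimage_bigcup; exact: mf.
Qed.

HB.instance Definition _ := isMeasure.Build _ _ _ nu nu0 nu_ge0 nu_sigma.

Let nu_tail : power_tail alpha nu.
Proof.
split.
  rewrite /tail_measure (_ : _ `&` _ = set0) ?measure0// -subset0 => u /=.
  rewrite !in_itv/= andbT => -[u0]; rewrite leNgt; apply/negP; rewrite negbK.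
  exact: powR_gt0.
move=> x x0; rewrite /tail_measure (_ : _ `&` _ = `]0, x `^ (- alpha)[%classic).
  by rewrite lebesgue_measure_itv/= lte_fin powR_gt0// -EFinD subr0.
have e u : 0 < u -> (x < f u) = (u < x `^ (- alpha)).
  move=> u0; rewrite -[LHS]ltr_ln ?posrE ?powR_gt0//.
  rewrite -[RHS]ltr_ln ?posrE ?powR_gt0// !ln_powR mulNr ltrNr.
  by rewrite ltr_pdivrMl// mulrN mulNr.
apply/seteqP; split => u /=; rewrite !in_itv/= !andbT.
  by move=> [u0]; rewrite e// u0.
by move=> /andP[u0]; rewrite e.
Qed.

Let nu_sigma_finite : sigma_finite setT nu.
Proof.
exists (fun n => `]-oo, 0] `|` `]n.+1%:R^-1, +oo[%classic).
  apply/seteqP; split => // x _; have [x0|x0] := leP x 0.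
    by exists 0%N => //; left; rewrite /= in_itv.
  have [n _ nx] := near_infty_natSinv_lt (PosNum x0).
  exists n => //; right; rewrite /= in_itv/= andbT.
  by apply: (nx n) => /=.
move=> n; split; first exact: measurableU.
rewrite measureU//; last first.
  rewrite -subset0 => x [] /=; rewrite !in_itv/= andbT => x0 nx.
  have := lt_le_trans nx x0.
  by rewrite ltNge invr_ge0 ler0n.
have [n0 nt] := nu_tail.
by rewrite [X in (X + _ < _)%E]n0 add0e [X in (X < _)%E]nt ?ltry.
Qed.

HB.instance Definition _ := Measure_isSigmaFinite.Build _ _ _ nu
  nu_sigma_finite.

Lemma power_tail_exists :
  exists nu : {sigma_finite_measure set R -> \bar R}, power_tail alpha nu.
Proof. by exists tail_measure; exact: nu_tail. Qed.

End existence.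
End tail.

Section limit_measure.
Variable R : realType.

Definition ordered_power (nu : {sigma_finite_measure set R -> \bar R}) j
    (A : set (j.-tuple R)) : \bar R :=
  power_measure nu j (A `&` [set y |
    (forall i k : 'I_j, (i <= k)%N -> tnth y k <= tnth y i) /\
    (forall i : 'I_j, 0 < tnth y i)]).

Context d (Om : measurableType d) (P : probability Om R).

Definition independent_RVs n (X : 'I_n -> {RV P >-> R}) : Prop :=
  forall (J : {set 'I_n}) (B : 'I_n -> set R),
    (forall i, i \in J -> measurable (B i)) ->
    P (\bigcap_(i in [set` J]) (X i @^-1` B i)) =
    (\prod_(i in J) P (X i @^-1` B i))%E.

Definition iid_uniform n (U : 'I_n -> {RV P >-> R}) : Prop :=
  independent_RVs U /\
  forall i (B : set R), measurable B ->
    distribution P (U i) B = uniform_prob (@ltr01 R) B.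

Definition C_measure (nu : {sigma_finite_measure set R -> \bar R}) j
    (U : 'I_j -> {RV P >-> R}) (B : set (skorokhod R)) : \bar R :=
  (\int[P]_w ordered_power nu
     [set y : j.-tuple R | B (jump_path (fun i => U i w) (tnth y))])%E.

End limit_measure.

(* Main.v *)
Require Import Defs.
From HB Require Import structures.
From mathcomp Require Import all_boot all_order all_algebra.
From mathcomp Require Import all_classical all_reals all_analysis.
From mathcomp Require Import measurable_realfun lra.

Set Implicit Arguments.
Unset Strict Implicit.
Unset Printing Implicit Defensive.

Import Order.TTheory GRing.Theory Num.Theory numFieldNormedType.Exports.
Import HBNNSimple.
Local Open Scope classical_set_scope.
Local Open Scope ring_scope.

(** Both sets are superlevel sets {Phi >= a} of one kind of functional,
      Phi xi = sup_t (xi t - c t - (q + 1) J^r_xi t + q J^(r+1)_xi t),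
    where J^m_xi t is the sum of the m largest jumps up to time t, with q = 0
    for the first set and q = r for the second.

    Phi is Lipschitz for the J1 distance.  If zeta composed with a time change h
    is uniformly within e of xi, then so are the left limits, hence jumps at
    corresponding times differ by at most 2e and J^m_xi t differs from
    J^m_zeta (h t) by at most 2me (jump_sum_sup_dist); moreover c t and c (h t)
    differ by at most |c| e.  As h permutes [0, 1], the suprema are close
    (sup_overshoot_continuous).  Continuity puts the boundary of {Phi >= a}
    inside the level set {Phi = a} (boundary_superlevel), without any
    description of the paths close to a given one.

    It remains to see that the level set is null.  On a path with r + 1 jumps
    y_1 >= ... >= y_(r+1) >= 0 at times u_i > 0, J^(r+1) is the path itself, and
    xi - J^r vanishes except that, if the u_i are distinct, it equals the
    smallest jump y_(r+1) once all of them have occurred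
    (overshoot_jump_path).  So, for distinct u_i, Phi = max(sup_t (- c t), (q + 1) y_(r+1) - c tau)
    where tau is the last jump time if c >= 0 and 1 otherwise.  The first term, which is
    the only one if some u_i coincide, is max(0, - c) < a: this is where a > 0
    and a + c > 0 enter.  Hence Phi = a
    forces y_(r+1) = (a + c tau) / (q + 1), a value depending on u alone
    (sup_overshoot_level).  The power-tail measure has no atoms, so for each u
    with positive entries this hyperplane is null.

    Nothing is known about the measurability of the sets involved: a measure may
    take any value on a nonmeasurable set.  Two facts avoid the question.  Any
    subset of a hyperplane y_i = x has all its slices in that coordinate empty or
    a subset of the slice at x, so iterated integration gives 0
    (power_measure_hyperplane); and a nonnegative function, measurable or not,
    that vanishes off a measurable null set has integral 0
    (ge0_integral_eq0_off_null), since the integral is a supremum over simple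
    functions below it. *)

(** * Null sets of product measures *)

(** The integral of a nonnegative function is a supremum over the simple functions
    below it; each of these is measurable and vanishes off N. *)
Lemma ge0_integral_eq0_off_null d (T : measurableType d) (R : realType)
    (mu : {measure set T -> \bar R}) (N : set T) (f : T -> \bar R) :
  measurable N -> mu N = 0%E -> (forall x, 0 <= f x)%E ->
  (forall x, ~ N x -> f x = 0%E) -> (\int[mu]_x f x = 0)%E.
Proof.
move=> mN N0 f0 fN; apply/eqP; rewrite eq_le integral_ge0// andbT.
rewrite ge0_integralTE//; apply: ge_ereal_sup => _ [h hf <-].
rewrite -integralT_nnsfun (ge0_negligible_integral mN)//.
- rewrite (eq_integral (cst 0%E)) ?integral0// => x; rewrite inE => -[_ Nx].
  have := hf x; rewrite fN// => hx.
  apply/eqP; rewrite eq_le hx lee_fin /=. exact: fun_ge0.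
- by apply/measurable_EFinP; exact: measurable_funTS.
- by move=> x _; rewrite lee_fin; exact: fun_ge0.
Qed.

(** Integrate one coordinate at a time.  If the first coordinate is the
    constrained one, all slices except the one at x are empty; otherwise every
    slice is contained in a hyperplane of lower dimension. *)
Lemma power_measure_hyperplane d (T : measurableType d) (R : realType)
    (nu : {sigma_finite_measure set T -> \bar R}) n (i : 'I_n) (x : T)
    (B : set (n.-tuple T)) :
  measurable [set x] -> nu [set x] = 0%E -> B `<=` [set y | tnth y i = x] ->
  power_measure nu n B = 0%E.
Proof.
move=> mx nux; elim: n i B => [[]//|n IH i B Bx].
rewrite /= /cons_measure /pushforward.
apply: (ge0_integral_eq0_off_null mx nux) => [z|z zx]; first exact: measure_ge0.
have [j ij|i0] := unliftP ord0 i.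
  apply: (IH j) => y; rewrite /xsection/= inE => /Bx /=.
  by rewrite ij tnthS.
rewrite /= (_ : xsection _ _ = set0) ?measure0// -subset0 => y.
by rewrite /xsection/= inE => /Bx; rewrite /= i0.
Qed.

(** For x > 0, compare the tails at x and at the point z < x where the tail is larger by
    exactly e: the atom fits in between. *)
Lemma power_tail_set1 (R : realType) (alpha : R)
    (nu : {measure set R -> \bar R}) (x : R) :
  0 < alpha -> power_tail alpha nu -> nu [set x] = 0%E.
Proof.
move=> alpha0 [nu0 nut]; have [x0|x0] := leP x 0.
  apply/eqP; rewrite -measure_le0 -nu0 le_measure ?inE//.
  by move=> _ ->; rewrite /= in_itv.
apply/eqP; rewrite -measure_le0; apply/lee_addgt0Pr => e e0; rewrite add0e.
pose b := x `^ (- alpha) + e.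
have b0 : 0 < b by rewrite addr_gt0// powR_gt0.
(* the solution of z `^ (- alpha) = b *)
pose z := b `^ (- alpha^-1).
have z0 : 0 < z by rewrite powR_gt0.
have zE : z `^ (- alpha) = b.
  by rewrite -powRrM mulrNN mulVf ?powRr1 ?ltW// gt_eqF.
have zx : z < x.
  rewrite ltNge; apply/negP => xz.
  have : (nu `]z, +oo[%classic <= nu `]x, +oo[%classic)%E.
    by apply: le_measure; rewrite ?inE//; apply: subset_itv; rewrite bnd_simp.
  by rewrite !nut// zE lee_fin /b -lerBrDl subrr leNgt e0.
have : (nu [set x] + nu `]x, +oo[%classic <= nu `]z, +oo[%classic)%E.
  rewrite -measureU//; last first.
    by rewrite -subset0 => t [] /= ->; rewrite in_itv/= ltxx.
  apply: le_measure; rewrite ?inE//; first exact: measurableU.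
  by move=> t [->|] /=; rewrite !in_itv/= !andbT//; exact: lt_trans.
by rewrite !nut// zE /b [in X in (_ <= X)%E]addrC EFinD leeD2rE.
Qed.

(** A jump at time 0 would not count as a jump, by the convention on the left
    limit at 0, so almost sure positivity of the times matters. *)
Lemma uniform_RVs_null d (Om : measurableType d) (R : realType)
    (P : probability Om R) n (U : 'I_n -> {RV P >-> R}) :
  (forall i (B : set R), measurable B ->
     distribution P (U i) B = uniform_prob (@ltr01 R) B) ->
  exists N, [/\ measurable N, P N = 0%E &
    forall w, ~ N w -> forall i, 0 < U i w <= 1].
Proof.
move=> hU.
pose N i := U i @^-1` (~` `]0, 1]%classic).
have mN i : measurable (N i).
  by rewrite -[N i]setTI; apply: measurable_funP => //; exact: measurableC.
have N0 i : P (N i) = 0%E.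
  have := hU i (~` `]0, 1]%classic) (measurableC (measurable_itv _)).
  rewrite /distribution /pushforward => ->.
  rewrite /uniform_prob integral_mkcond.
  apply: (@ge0_integral_eq0_off_null _ _ R (@lebesgue_measure R) [set 0]).
  - exact: measurable_set1.
  - exact: lebesgue_measure_set1.
  - move=> x; rewrite patchE; case: ifP => // _.
    by rewrite lee_fin uniform_pdf_ge0.
  - move=> x x0; rewrite patchE; case: ifPn => //; rewrite inE /= in_itv/=.
  move=> x01; congr EFin; rewrite /uniform_pdf; case: ifPn => // /andP[x0' x1].
  by exfalso; apply: x01; rewrite x1 andbT lt_neqAle x0' andbT eq_sym; exact/eqP.
exists (\bigcup_(i in [set: 'I_n]) N i); split.
- exact: fin_bigcup_measurable.
- apply/eqP; rewrite -measure_le0.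
  have : (P (\bigcup_(i in [set: 'I_n]) N i) <= \sum_(i \in [set: 'I_n]) P (N i))%E.
    apply: content_sub_fsum => //; first exact: finite_finset.
    exact: fin_bigcup_measurable.
  by rewrite fsbig1.
- move=> w Nw i; apply: contrapT => Uw; apply: Nw; exists i => //.
Qed.

(** * Jumps of step paths *)

Lemma jump_pathE (R : realType) n (u y : 'I_n -> R) (t : R) : 0 <= t <= 1 ->
  jump_path u y t = \sum_(i < n) y i * (u i <= t)%R%:R.
Proof.
move=> t01; rewrite /= /jump_fun patchE mem_setE in_itv/= t01.
apply: eq_bigr => i _; rewrite indicE mem_setE in_itv/=.
by case/andP: t01 => _ ->; rewrite andbT.
Qed.

Lemma left_limit_jump_path (R : realType) n (u y : 'I_n -> R) (t : R) :
  0 < t <= 1 ->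
  left_limit (jump_path u y) t = \sum_(i < n) y i * (u i < t)%R%:R.
Proof.
move=> /andP[t0 t1]; rewrite /left_limit gt_eqF//; apply: cvg_lim => //.
apply: (@cvg_trans _ (\sum_(i < n) y i * (u i <= x)%R%:R @[x --> t^'-])).
  apply: near_eq_cvg; near=> x; rewrite jump_pathE//; apply/andP; split.
    by near: x; exact: nbhs_left_ge.
  by rewrite (le_trans _ t1).
apply: cvg_big => [|i _]; [exact: add_continuous|apply: cvg_near_cst].
case: (ltP (u i) t) => ut; near=> x; congr (_ * (nat_of_bool _)%:R).
  by near: x; exact: nbhs_left_ge.
by apply/negbTE; rewrite -ltNge; apply: lt_le_trans ut.
Unshelve. all: by end_near. Qed.

Lemma jump_jump_path (R : realType) n (u y : 'I_n -> R) (t : R) :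
  (forall i, 0 < u i) -> 0 <= t <= 1 ->
  jump (jump_path u y) t = \sum_(i < n) y i * (u i == t)%:R.
Proof.
move=> u0 /andP[]; rewrite le_eqVlt => /predU1P[<- _|t0 t1].
  rewrite /jump /left_limit eqxx subrr big1// => i _.
  by rewrite gt_eqF ?mulr0// u0.
rewrite /jump left_limit_jump_path ?t0// jump_pathE ?(ltW t0)//.
rewrite -sumrB; apply: eq_bigr => i _.
by rewrite -mulrBr; case: ltgtP => _; rewrite /= ?subrr ?subr0.
Qed.

(** Distinct times collect each jump at most once. *)
Lemma sum_jump_path (R : realType) n m (u y : 'I_n -> R) (s : 'I_m -> R) :
  (forall i, 0 < u i) -> (forall k, 0 <= s k <= 1) -> injective s ->
  \sum_(k < m) jump (jump_path u y) (s k) =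
  \sum_(i < n) y i * (u i \in codom s)%:R.
Proof.
move=> u0 s01 sI; under eq_bigr do rewrite jump_jump_path//.
rewrite exchange_big/=; apply: eq_bigr => i _; rewrite -mulr_sumr.
congr (_ * _); case: (boolP (u i \in codom s)) => [/codomP[k ->]|us].
  rewrite (bigD1 k)//= eqxx big1 ?addr0// => l lk.
  by rewrite (inj_eq sI) eq_sym (negbTE lk).
by rewrite big1// => k _; case: eqP => // uk; rewrite uk codom_f in us.
Qed.

(** Turns a bound on the number of jump times into an admissible choice of exactly
    m times: the missing times are taken among t, t/2, t/3, ... *)
Lemma extend_injection (R : realType) m (t : R) (l : seq R) :
  0 < t -> (size l <= m)%N -> (forall x, x \in l -> 0 <= x <= t) ->
  exists s : 'I_m -> R, [/\ injective s, forall k, 0 <= s k <= t &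
    forall x, x \in l -> x \in codom s].
Proof.
move=> t0 lm lt.
pose c := mkseq (fun i => t / i.+1%:R) m.
have cU : uniq c.
  apply/mkseq_uniqP => i j _ _ /(mulfI (lt0r_neq0 t0))/invr_inj/eqP.
  by rewrite eqr_nat eqSS => /eqP.
have ct x : x \in c -> 0 <= x <= t.
  move=> /mapP[i _ ->]; rewrite divr_ge0 ?(ltW t0)//=.
  by rewrite ler_pdivrMr// ler_peMr ?(ltW t0)// ler1n.
pose v := undup l; pose w := v ++ [seq x <- c | x \notin v].
have wU : uniq w.
  rewrite cat_uniq undup_uniq filter_uniq// andbT /=.
  by apply/hasPn => x; rewrite mem_filter => /andP[].
have wm : (m <= size w)%N.
  rewrite -[m in (m <= _)%N](size_mkseq (fun i => t / i.+1%:R)).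
  apply: uniq_leq_size => // x xc.
  by rewrite mem_cat mem_filter xc andbT; case: (x \in v).
have vm : (size v <= m)%N by rewrite (leq_trans (size_undup _)).
have wt x : x \in w -> 0 <= x <= t.
  rewrite mem_cat mem_filter mem_undup => /orP[/lt//|/andP[_ /ct]] //.
have km (k : 'I_m) : (k < size w)%N by exact: leq_trans wm.
exists (fun k => nth 0 w k); split.
- by move=> j k /eqP; rewrite nth_uniq// => /eqP/val_inj.
- by move=> k; apply: wt; exact: mem_nth.
- move=> x; rewrite -mem_undup -/v => xv.
  have xm : (index x v < m)%N by rewrite (leq_trans _ vm)// index_mem.
  apply/codomP; exists (Ordinal xm) => /=.
  by rewrite nth_cat index_mem xv nth_index.
Qed.

Lemma jump_sum_sup_ge (R : realType) n m (u y : 'I_n -> R) (t : R) (l : seq R) :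
  (forall i, 0 < u i) -> (forall i, 0 <= y i) -> 0 < t <= 1 ->
  (size l <= m)%N -> (forall x, x \in l -> 0 <= x <= t) ->
  \sum_(i < n) y i * (u i \in l)%:R <= jump_sum_sup m (jump_path u y) t.
Proof.
move=> u0 y0 t01 lm lt; have /andP[t0 t1] := t01.
have [s [sI st ls]] := extend_injection t0 lm lt.
apply: (@le_trans _ _ (\sum_(k < m) jump (jump_path u y) (s k))).
  rewrite sum_jump_path//; last first.
    by move=> k; have /andP[-> /le_trans ->] := st k.
  apply: ler_sum => i _; apply: ler_wpM2l => //; rewrite ler_nat.
  by case: (boolP (u i \in l)) => // /ls ->.
rewrite /jump_sum_sup gt_eqF//; apply: ub_le_sup; last by exists s.
by case: (has_sup_jump_sums m (jump_path u y) t01).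
Qed.

Lemma jump_sum_sup_le (R : realType) n m (u y : 'I_n -> R) (t b : R) :
  (forall i, 0 < u i) -> 0 < t <= 1 ->
  (forall s : 'I_m -> R, (forall k, 0 <= s k <= t) -> injective s ->
    \sum_(i < n) y i * (u i \in codom s)%:R <= b) ->
  jump_sum_sup m (jump_path u y) t <= b.
Proof.
move=> u0 t01 sb; have /andP[t0 t1] := t01.
rewrite /jump_sum_sup gt_eqF//; apply: ge_sup.
  by case: (has_sup_jump_sums m (jump_path u y) t01).
move=> _ [s [st sI] <-]; rewrite sum_jump_path//; first exact: sb.
by move=> k; have /andP[-> /le_trans ->] := st k.
Qed.

Definition jump_times (R : realType) n (u : 'I_n -> R) (t : R) : seq R :=
  [seq u i | i <- enum 'I_n & u i <= t].

Lemma mem_jump_times (R : realType) n (u : 'I_n -> R) (t : R) i :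
  u i <= t -> u i \in jump_times u t.
Proof. by move=> ut; rewrite map_f// mem_filter ut mem_enum. Qed.

Lemma size_jump_times (R : realType) n (u : 'I_n -> R) (t : R) :
  (size (jump_times u t) <= n)%N.
Proof.
by rewrite size_map size_filter (leq_trans (count_size _ _))// size_enum_ord.
Qed.

(** With at most m distinct jump times up to t, the m largest jumps make up the
    whole path. *)
Lemma jump_sum_sup_all (R : realType) n m (u y : 'I_n -> R) (t : R) :
  (forall i, 0 < u i) -> (forall i, 0 <= y i) -> 0 <= t <= 1 ->
  (size (undup (jump_times u t)) <= m)%N ->
  jump_sum_sup m (jump_path u y) t = jump_path u y t.
Proof.
move=> u0 y0 t01 um; rewrite jump_pathE//.
have /andP[] := t01; rewrite le_eqVlt => /predU1P[<- _|t0 t1].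
  rewrite /jump_sum_sup eqxx big1// => i _.
  by rewrite leNgt u0 mulr0.
apply/eqP; rewrite eq_le; apply/andP; split.
  apply: jump_sum_sup_le; rewrite ?t0// => s st sI.
  apply: ler_sum => i _; apply: ler_wpM2l => //; rewrite ler_nat.
  case: (boolP (u i \in codom s)) => // /codomP[k ->].
  by have /andP[_ ->] := st k.
apply: (@le_trans _ _ (\sum_(i < n) y i * (u i \in undup (jump_times u t))%:R)).
  apply: ler_sum => i _; apply: ler_wpM2l => //; rewrite ler_nat mem_undup.
  by case: (boolP (u i <= t)) => // /mem_jump_times ->.
apply: jump_sum_sup_ge; rewrite ?t0// => x.
rewrite mem_undup => /mapP[i]; rewrite mem_filter => /andP[ut _] ->.
by rewrite ut (ltW (u0 i)).
Qed.

(** By pigeonhole r times miss at least one of r + 1 distinct jump times, and the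
    best choice misses a smallest jump. *)
Lemma jump_sum_sup_all_but_one (R : realType) r (u y : 'I_r.+1 -> R) (t : R) :
  (forall i, 0 < u i) -> (forall i, 0 <= y i) ->
  (forall i, y ord_max <= y i) -> injective u -> (forall i, u i <= t) -> t <= 1 ->
  jump_sum_sup r (jump_path u y) t = jump_path u y t - y ord_max.
Proof.
move=> u0 y0 ymax uI ut t1.
have t0 : 0 < t := lt_le_trans (u0 ord0) (ut ord0).
have -> : jump_path u y t = \sum_(i < r.+1) y i.
  by rewrite jump_pathE ?(ltW t0)//; apply: eq_bigr => i _; rewrite ut mulr1.
apply/eqP; rewrite eq_le; apply/andP; split.
  apply: jump_sum_sup_le; rewrite ?t0// => s st sI.
  have [i us] : exists i, u i \notin codom s.
    apply/existsP; apply: contraT; rewrite negb_exists => /forallP us.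
    suff : (size (codom u) <= size (codom s))%N.
      by rewrite !size_codom !card_ord ltnn.
    apply: uniq_leq_size; first by rewrite map_inj_uniq// enum_uniq.
    by move=> _ /codomP[i ->]; have := us i; rewrite negbK.
  rewrite lerBrDr (bigD1 i)//= (negbTE us) mulr0 add0r [leRHS](bigD1 i)//=.
  rewrite addrC lerD// ler_sum// => j _.
  by case: (_ \in _); rewrite ?mulr1 ?mulr0.
pose l := [seq u i | i <- enum 'I_r.+1 & i != ord_max].
apply: (@le_trans _ _ (\sum_(i < r.+1) y i * (u i \in l)%:R)).
  rewrite (bigD1 ord_max)//= [y _ + _]addrC addrK [leRHS](bigD1 ord_max)//=.
  apply: (@le_trans _ _ (\sum_(i < r.+1 | i != ord_max) y i * (u i \in l)%:R)).
    apply: ler_sum => i im.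
    by rewrite map_f ?mulr1// mem_filter im mem_enum.
  by rewrite lerDr mulr_ge0.
apply: jump_sum_sup_ge; rewrite ?t0//.
  rewrite size_map -ltnS -[X in (_ < X)%N](size_enum_ord r.+1) size_filter.
  rewrite -[X in (_ < X)%N](count_predC (fun i => i != ord_max)).
  rewrite -[X in (X < _)%N]addn0 ltn_add2l -has_count.
  by apply/hasP; exists ord_max; rewrite ?mem_enum//= negbK.
by move=> x /mapP[i _ ->]; rewrite ut ltW.
Qed.

Lemma size_undup_jump_times (R : realType) r (u : 'I_r.+1 -> R) (t : R) :
  ~ (injective u /\ forall i, u i <= t) ->
  (size (undup (jump_times u t)) <= r)%N.
Proof.
move=> nu; rewrite leqNgt; apply/negP => ru; apply: nu.
have sz : size (jump_times u t) = r.+1.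
  by apply/eqP; rewrite eqn_leq size_jump_times (leq_trans ru)// size_undup.
have U : uniq (jump_times u t).
  by rewrite -[uniq _]negbK -ltn_size_undup sz -leqNgt.
have all_le : all (fun i => u i <= t) (enum 'I_r.+1).
  by rewrite all_count -size_filter -(size_map u) sz size_enum_ord.
have ut i : u i <= t by apply: (allP all_le); rewrite mem_enum.
split => //; apply/injectiveP.
by move: U; rewrite /jump_times (all_filterP all_le).
Qed.

(** * The overshoot on step paths *)

(** The coefficients are those for which a path equal to both J^r and J^(r+1)
    leaves only the drift - c t. *)
Definition overshoot (R : realType) r (q c : R) (xi : skorokhod R) (t : R) : R :=
  xi t - c * t - (q + 1) * jump_sum_sup r xi t + q * jump_sum_sup r.+1 xi t.

Definition sup_overshoot (R : realType) r (q c : R) (xi : skorokhod R) : R :=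
  sup [set overshoot r q c xi t | t in `[0, 1]].

Lemma overshoot_jump_path (R : realType) r (q c : R) (u y : 'I_r.+1 -> R) (t : R) :
  (forall i, 0 < u i) -> (forall i, 0 <= y i) ->
  (forall i, y ord_max <= y i) -> 0 <= t <= 1 ->
  overshoot r q c (jump_path u y) t =
  (q + 1) * (y ord_max * (`[< injective u /\ forall i, u i <= t >] : nat)%:R) - c * t.
Proof.
move=> u0 y0 ymax t01; rewrite /overshoot.
rewrite (@jump_sum_sup_all _ _ r.+1)//; last first.
  by rewrite (leq_trans (size_undup _))// size_jump_times.
case: asboolP => [[uI ut]|nu].
  rewrite jump_sum_sup_all_but_one//; last by case/andP: t01.
  by rewrite mulr1; lra.
rewrite jump_sum_sup_all ?size_undup_jump_times//.
by rewrite !mulr0; lra.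
Qed.

(** The supremum is the larger of a term at most max(0, - c) < a, contributed by
    the times before all jumps have occurred, and (q + 1) * y ord_max - c * tau, attained at tau.
    If two jump times coincide only the first term is present and the level a is
    not reached at all. *)
Lemma sup_overshoot_level (R : realType) r (q c a : R) (u : 'I_r.+1 -> R) :
  0 <= q -> 0 < a -> 0 < a + c -> (forall i, 0 < u i <= 1) ->
  exists x, forall y : 'I_r.+1 -> R, (forall i, 0 <= y i) ->
    (forall i, y ord_max <= y i) ->
    sup_overshoot r q c (jump_path u y) = a -> y ord_max = x.
Proof.
move=> q0 a0 ac0 u01.
have u0 i : 0 < u i by case/andP: (u01 i).
have [j uj] : exists j, forall i, u i <= u j.
  exists [arg max_(i > ord0) u i]%O; case: arg_maxP => //= i _ ui k.
  exact: ui.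
(* tau minimizes c * t over the times after the last jump *)
pose tau := if 0 <= c then u j else 1.
have tau01 : 0 <= tau <= 1.
  by rewrite /tau; case: ifP => _; rewrite ?ler01 ?lexx// ltW//=; case/andP: (u01 j).
have utau i : u i <= tau.
  by rewrite /tau; case: ifP => // _; case/andP: (u01 i).
have q10 : 0 < q + 1 by rewrite ltr_wpDl.
exists ((a + c * tau) / (q + 1)) => y y0 ymax supE.
pose b (t : R) : R := (`[< injective u /\ forall i, u i <= t >] : nat)%:R.
have fE t : 0 <= t <= 1 ->
    overshoot r q c (jump_path u y) t = (q + 1) * (y ord_max * b t) - c * t.
  exact: overshoot_jump_path.
have ctau t : 0 <= t <= 1 -> (forall i, u i <= t) -> c * tau <= c * t.
  move=> /andP[t0 t1] ut; rewrite /tau; case: ifPn => [c0|].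
    by apply: ler_wpM2l.
  by rewrite -ltNge mulr1 => c0; rewrite ler_nMr.
have ct t : 0 <= t <= 1 -> - (c * t) <= Num.max 0 (- c).
  move=> /andP[t0 t1]; rewrite le_max; have [c0|c0] := leP 0 c.
    by rewrite oppr_le0 mulr_ge0.
  by rewrite lerN2 ler_nMr ?t1 ?orbT.
have ma : Num.max 0 (- c) < a by rewrite gt_max a0/=; lra.
have [uI|nuI] := pselect (injective u); last first.
  exfalso; move: ma; rewrite ltNge => /negP; apply; rewrite -supE.
  apply: ge_sup; first by eexists; exists 0 => //; rewrite /= in_itv/= lexx ler01.
  move=> _ [t + <-]; rewrite /= in_itv/= => t01.
  rewrite fE// /b; case: asboolP => [[]//|_].
  by rewrite !mulr0 add0r; exact: ct.
pose v := (q + 1) * y ord_max - c * tau.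
have bnd t : 0 <= t <= 1 ->
    overshoot r q c (jump_path u y) t <= Num.max (Num.max 0 (- c)) v.
  move=> t01; rewrite fE// /b le_max; case: asboolP => [[_ ut]|_].
    by rewrite mulr1 /v lerD2l lerN2 ctau ?orbT.
  by rewrite !mulr0 add0r ct.
have va : v <= a.
  rewrite -supE; apply: ub_le_sup.
    exists (Num.max (Num.max 0 (- c)) v) => _ [t + <-]; rewrite /= in_itv/= => t01.
    exact: bnd.
  exists tau; first by rewrite /= in_itv.
  by rewrite fE// /b asboolT// mulr1.
have av : a <= v.
  have : a <= Num.max (Num.max 0 (- c)) v.
    rewrite -supE; apply: ge_sup.
      by eexists; exists 0 => //; rewrite /= in_itv/= lexx ler01.
    by move=> _ [t + <-]; rewrite /= in_itv/= => t01; exact: bnd.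
  by rewrite le_max leNgt ma.
have vE : v = a by apply/eqP; rewrite eq_le va av.
by rewrite -vE /v subrK mulrC mulKf// gt_eqF.
Qed.

(** * Continuity in the J1 distance *)

Lemma time_change0 (R : realType) (h : R -> R) : time_change h -> h 0 = 0.
Proof.
move=> hh; have [g hg /(_ 0)] := time_change_inv hh.
rewrite lexx ler01 => /(_ isT)[/andP[]]; rewrite le_eqVlt => /predU1P[g0|g0] g1 e.
  by rewrite [in LHS]g0 e.
have [_ hi _] := hh; have := hi 0 (g 0).
rewrite !in_itv/= (ltW g0) g1 lexx ler01 => /(_ isT isT g0); rewrite e.
have := time_change01 hh; move=> /(_ 0); rewrite ler01 lexx => /(_ isT).
by move=> /andP[+ _ ?]; lra.
Qed.

Lemma time_change_at_left (R : realType) (h : R -> R) (t : R) :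
  time_change h -> 0 < t <= 1 -> h s @[s --> t^'-] --> (h t)^'-.
Proof.
move=> [_ hi hc] /andP[t0 t1].
have hl : h s @[s --> t^'-] --> h t.
  move: hc => /(continuous_within_itvP _ ltr01)[hin _ h1].
  move: t1; rewrite le_eqVlt => /predU1P[->//|t1].
  by apply: cvg_at_left_filter; apply: hin; rewrite in_itv/= t0.
move=> A /= /hl hA.
have lt_h : \forall s \near t^'-, h s < h t.
  near=> s; have st : s < t by near: s; exact: nbhs_left_lt.
  have s0 : 0 < s by near: s; exact: nbhs_left_gt.
  by apply: hi => //; rewrite in_itv/= ltW//= ltW// (lt_le_trans st).
by apply: filterS2 hA lt_h => s As; exact: As.
Unshelve. all: by end_near. Qed.

(** A time change sends the left filter at t to the one at h t, so the bound
    passes to the limit; at 0 the convention on left limits agrees, because h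
    fixes 0. *)
Lemma left_limit_dist (R : realType) (x y : skorokhod R) (h : R -> R) (e t : R) :
  time_change h -> (forall s, 0 <= s <= 1 -> `|x s - y (h s)| <= e) ->
  0 <= t <= 1 -> `|left_limit x t - left_limit y (h t)| <= e.
Proof.
move=> hh he /andP[]; rewrite le_eqVlt => /predU1P[<- _|t0 t1].
  rewrite /left_limit eqxx (time_change0 hh) eqxx.
  by rewrite -[in y 0](time_change0 hh); apply: he; rewrite lexx ler01.
have t01 : 0 < t <= 1 by rewrite t0.
have t01' : 0 <= t <= 1 by rewrite ltW.
have ht0 : 0 < h t.
  by have [_ hi _] := hh; rewrite -(time_change0 hh) hi// in_itv/= ?lexx ?ler01// ltW.
have ht01 : 0 < h t <= 1.
  by rewrite ht0; have /andP[] := time_change01 hh t01'.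
rewrite /left_limit !gt_eqF//.
have cx := (skfun_cadlag x).2 t t01.
have cy := (skfun_cadlag y).2 (h t) ht01.
have cyh : y (h s) @[s --> t^'-] --> lim (y s @[s --> (h t)^'-]).
  exact: cvg_comp (time_change_at_left hh t01) cy.
have cd : `|x s - y (h s)| @[s --> t^'-] -->
    `|lim (x s @[s --> t^'-]) - lim (y s @[s --> (h t)^'-])|.
  by apply: cvg_norm; exact: cvgB.
apply: (cvgr_to_le cd).
near=> s; apply: he; apply/andP; split.
  by near: s; exact: nbhs_left_ge.
by apply: le_trans t1; near: s; exact: nbhs_left_le.
Unshelve. all: by end_near. Qed.

Lemma jump_dist (R : realType) (x y : skorokhod R) (h : R -> R) (e t : R) :
  time_change h -> (forall s, 0 <= s <= 1 -> `|x s - y (h s)| <= e) ->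
  0 <= t <= 1 -> `|jump x t - jump y (h t)| <= 2 * e.
Proof.
move=> hh he t01; have := he _ t01; have := left_limit_dist hh he t01.
by rewrite /jump !ler_norml => /andP[? ?] /andP[? ?]; apply/andP; split; lra.
Qed.

(** Transport an admissible choice of times for x through h. *)
Lemma jump_sum_sup_le_time_change (R : realType) m (x y : skorokhod R)
    (h : R -> R) (e t : R) :
  time_change h -> (forall s, 0 <= s <= 1 -> `|x s - y (h s)| <= e) ->
  0 <= t <= 1 ->
  jump_sum_sup m x t <= jump_sum_sup m y (h t) + m%:R * (2 * e).
Proof.
move=> hh he /andP[]; rewrite le_eqVlt => /predU1P[<- _|t0 t1].
  rewrite /jump_sum_sup eqxx (time_change0 hh) eqxx add0r !mulr_ge0//.
  by apply: le_trans (he 0 _); rewrite ?lexx ?ler01.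
have t01 : 0 < t <= 1 by rewrite t0.
have [_ hi _] := hh.
have hmono := le_mono_in hi.
have in01 (s : R) : 0 <= s <= 1 -> s \in `[0, 1] by rewrite in_itv.
have t01' : 0 <= t <= 1 by rewrite ltW.
have ht0 : 0 < h t.
  by rewrite -(time_change0 hh) hi// in01// lexx ler01.
have ht01 : 0 < h t <= 1.
  by rewrite ht0; have /andP[] := time_change01 hh t01'.
rewrite /jump_sum_sup !gt_eqF//; apply: ge_sup.
  by case: (has_sup_jump_sums m x t01).
move=> _ [s [st sI] <-].
have s01 i : 0 <= s i <= 1 by have /andP[-> /le_trans ->] := st i.
apply: (@le_trans _ _ (\sum_(i < m) (jump y (h (s i)) + 2 * e))).
  apply: ler_sum => i _; have := jump_dist hh he (s01 i).
  by rewrite ler_norml => /andP[_]; lra.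
rewrite big_split/= sumr_const card_ord -[X in _ + X]mulr_natl lerD2r.
apply: ub_le_sup; first by case: (has_sup_jump_sums m y ht01).
exists (h \o s) => //; split=> [i /=|i j /= hij].
  have /andP[-> _] := time_change01 hh (s01 i).
  by rewrite hmono ?in01//; case/andP: (st i).
apply: sI; apply/eqP; rewrite eq_le.
by rewrite -[s i <= _]hmono ?in01// -[s j <= _]hmono ?in01// hij lexx.
Qed.

(** The other inequality is the same one for the inverse time change. *)
Lemma jump_sum_sup_dist (R : realType) m (x y : skorokhod R)
    (h : R -> R) (e t : R) :
  time_change h -> (forall s, 0 <= s <= 1 -> `|x s - y (h s)| <= e) ->
  0 <= t <= 1 ->
  `|jump_sum_sup m x t - jump_sum_sup m y (h t)| <= m%:R * (2 * e).
Proof.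
move=> hh he t01; have [g hg hgK] := time_change_inv hh.
have ht01 := time_change01 hh t01.
have ghK : g (h t) = t.
  have [[_ hI _] _ _] := hh; have [g01 gK] := hgK _ ht01.
  by apply: hI => //; rewrite inE/= in_itv.
have ge s : 0 <= s <= 1 -> `|y s - x (g s)| <= e.
  by move=> /hgK[gs {1}<-]; rewrite distrC; exact: he.
have := jump_sum_sup_le_time_change m hh he t01.
have := jump_sum_sup_le_time_change m hg ge ht01; rewrite ghK.
by move=> ? ?; rewrite ler_norml; apply/andP; split; lra.
Qed.

Lemma overshoot_le (R : realType) r (q c : R) : 0 <= q ->
  exists2 k : R, 0 < k & forall (x y : skorokhod R) (h : R -> R) (e t : R),
  time_change h ->
  (forall s, 0 <= s <= 1 -> `|h s - s| <= e /\ `|x s - y (h s)| <= e) ->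
  0 <= t <= 1 -> overshoot r q c x t <= overshoot r q c y (h t) + k * e.
Proof.
move=> q0.
exists (1 + `|c| + (q + 1) * (r%:R * 2) + q * (r.+1%:R * 2)).
  by rewrite ltr_wpDr ?mulr_ge0// ltr_wpDr ?mulr_ge0 ?addr_ge0// ltr_wpDr.
move=> x y h e t hh he t01.
have hx s : 0 <= s <= 1 -> `|x s - y (h s)| <= e by case/he.
have Jr := jump_sum_sup_dist r hh hx t01.
have Jr1 := jump_sum_sup_dist r.+1 hh hx t01.
have [ht xt] := he _ t01.
have ct : `|c * (h t - t)| <= `|c| * e by rewrite normrM ler_wpM2l.
have {}Jr := ler_wpM2l (addr_ge0 q0 ler01) Jr.
have {}Jr1 := ler_wpM2l q0 Jr1.
rewrite -{1}[q + 1]ger0_norm ?addr_ge0// -normrM in Jr.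
rewrite -{1}[q]ger0_norm// -normrM in Jr1.
move: xt ct Jr Jr1; rewrite /overshoot !ler_norml.
by move=> /andP[? ?] /andP[? ?] /andP[? ?] /andP[? ?]; lra.
Qed.

(** Needed because a supremum over an unbounded set is 0 by convention.  The bound
    comes from comparing x with the null path through the identity time
    change, the distance being a uniform bound of x. *)
Lemma overshoot_bounded (R : realType) r (q c : R) (x : skorokhod R) : 0 <= q ->
  has_ubound [set overshoot r q c x t | t in `[0, 1]].
Proof.
move=> q0; have [k k0 kP] := overshoot_le r c q0.
have [M xM] := cadlag_bounded (skfun_cadlag x).
pose z : skorokhod R := jump_path (fun _ : 'I_0 => 0) (fun _ => 0).
have zE t : 0 <= t <= 1 -> z t = 0 by move=> ?; rewrite jump_pathE// big_ord0.
have Jz m t : 0 <= t <= 1 -> jump_sum_sup m z t = 0.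
  move=> t01; rewrite jump_sum_sup_all ?zE//; try by case.
  by rewrite (leq_trans (size_undup _))// (leq_trans (size_jump_times _ _)).
exists (`|c| + k * M) => _ [t + <-]; rewrite /= in_itv/= => t01.
have M0 : 0 <= M by apply: le_trans (xM _ t01).
apply: (le_trans (kP x z id M t (time_change_id R) _ t01)).
  move=> s s01; split; first by rewrite /= subrr normr0.
  by rewrite zE// subr0; exact: xM.
rewrite lerD2r /overshoot zE// !Jz// !mulr0 addr0 subr0 add0r.
rewrite (le_trans (ler_norm _))// normrN normrM ler_piMr//.
by case/andP: t01 => t0 t1; rewrite ger0_norm.
Qed.

Lemma sup_overshoot_continuous (R : realType) r (q c : R) : 0 <= q ->
  continuous (@sup_overshoot R r q c : skorokhod R -> R).
Proof.
move=> q0; have [k k0 kP] := overshoot_le r c q0.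
have le_sup (x y : skorokhod R) e : J1_dist x y < e ->
    sup_overshoot r q c x <= sup_overshoot r q c y + k * e.
  move=> /J1_dist_lt[h hh he]; apply: ge_sup.
    by eexists; exists 0 => //; rewrite /= in_itv/= lexx ler01.
  move=> _ [t + <-]; rewrite /= in_itv/= => t01.
  apply: (le_trans (kP x y h e t hh _ t01)).
    by move=> s /he[? ?]; rewrite !ltW.
  rewrite lerD2r; apply: ub_le_sup; first exact: overshoot_bounded.
  by exists (h t) => //; rewrite /= in_itv/=; exact: time_change01.
move=> x; apply/(@cvgrPdist_le _ _ _ (nbhs x) (nbhs_filter x)) => e e0.
apply/nbhs_ballP; exists (e / k); first by rewrite /= divr_gt0.
move=> y; rewrite ballEmdist /= mdistE => xy.
have := le_sup _ _ _ xy; have := le_sup y x (e / k).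
rewrite J1_dist_sym => /(_ xy); rewrite mulrC divfK ?gt_eqF//.
by move=> ? ?; rewrite ler_norml; apply/andP; split; lra.
Qed.

(** * Nullity of the boundaries *)

Lemma boundary_superlevel (T : topologicalType) (R : realType) (f : T -> R) (a : R) :
  continuous f -> boundary [set x | a <= f x] `<=` [set x | f x = a].
Proof.
move=> fc x [xc xi]; apply/eqP; rewrite eq_le; apply/andP; split.
  rewrite leNgt; apply/negP => ax; apply: xi.
  suff : nbhs x [set y | a < f y] by apply: filterS => y; exact: ltW.
  exact: cvgr_gt (fc x) _ ax.
rewrite leNgt; apply/negP => ax.
have [|y [ay ya]] := xc [set y | f y < a].
  exact: cvgr_lt (fc x) _ ax.
by have := le_lt_trans ay ya; rewrite ltxx.
Qed.

Lemma C_measure_boundary0 (R : realType) r (alpha a c q : R) :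
  0 <= q -> 0 < alpha -> 0 < a -> 0 < a + c ->
  forall (nu : {sigma_finite_measure set R -> \bar R}), power_tail alpha nu ->
  forall (d : measure_display) (Om : measurableType d) (P : probability Om R)
    (U : 'I_r.+1 -> {RV P >-> R}),
  (forall i (B : set R), measurable B ->
     distribution P (U i) B = uniform_prob (@ltr01 R) B) ->
  C_measure nu U (boundary [set xi | a <= sup_overshoot r q c xi]) = 0%E.
Proof.
move=> q0 alpha0 a0 ac0 nu nut d Om P U hU.
have [N [mN PN NU]] := uniform_RVs_null hU.
apply: (ge0_integral_eq0_off_null mN PN) => [w|w /NU Uw]; first exact: measure_ge0.
have [x xP] := sup_overshoot_level q0 a0 ac0 Uw.
apply: (@power_measure_hyperplane _ _ _ nu _ ord_max x).
- exact: measurable_set1.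
- exact: power_tail_set1 nut.
- move=> y [/(boundary_superlevel (sup_overshoot_continuous q0))/= ya [yle y0]].
  by apply: xP ya => i; [rewrite ltW|apply: yle; exact: leq_ord].
Qed.

Theorem lemma3p7 (R : realType) (r : nat) (alpha a c : R)
    (r_gt0 : (0 < r)%N) (alpha_gt1 : 1 < alpha) (a_gt0 : 0 < a)
    (ac_gt0 : 0 < a + c)
    (nu : {sigma_finite_measure set R -> \bar R})
    (nu_tail : power_tail alpha nu)
    (d : measure_display) (Om : measurableType d) (P : probability Om R)
    (U : 'I_r.+1 -> {RV P >-> R}) (U_iid : iid_uniform U) :
  C_measure nu U (boundary (A_set r c a)) = 0%E /\
  C_measure nu U (boundary (calA_set r c a)) = 0%E.
Proof.
have alpha_gt0 : 0 < alpha by exact: lt_trans alpha_gt1.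
have [_ U_unif] := U_iid.
split.
  rewrite (_ : A_set r c a = [set xi | a <= sup_overshoot r 0 c xi]).
    exact: C_measure_boundary0 alpha_gt0 _ _ _ nu_tail _ _ _ _ U_unif.
  apply/funext => xi; rewrite /A_set /sup_overshoot /=; congr (is_true (_ <= sup _)).
  by apply: eq_imagel => t _; rewrite /overshoot add0r mul1r mul0r addr0.
rewrite (_ : calA_set r c a = [set xi | a <= sup_overshoot r r%:R c xi]).
  exact: C_measure_boundary0 alpha_gt0 _ _ _ nu_tail _ _ _ _ U_unif.
apply/funext => xi; rewrite /calA_set /sup_overshoot /=; congr (is_true (_ <= sup _)).
by apply: eq_imagel => t _; rewrite /overshoot -natr1.
Qed.
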